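(* Let $m\ge 3$, $k\in\{1,\dots,m-2\}$ and $n\ge 6$ be integers, and consider approval elections with a set $N$ of $n$ agents and a set $A$ of $m$ alternatives, with committees of size $k$. Then any strongly group-strategyproof multi-winner approval-based voting rule $R$ has an infinite approximation ratio for $k$-minimax approval voting; that is, there is no finite $\rho\ge 1$ such that $D(R(P),P)\le \rho\cdot \min_{K}D(K,P)$ for every approval profile $P$, where $K$ ranges over the subsets of $A$ of size $k$.
   Context: An approval profile is a tuple $P=(P_i)_{i\in N}$ with $P_i\subseteq A$ an arbitrary subset (any size, including empty, is allowed). A committee of size $k$ is a set $S\subseteq A$ with $|S|=k$. A multi-winner approval-based voting rule $R$ is a (deterministic) function assigning to every approval profile $P$ a committee $R(P)$ of size $k$. For $Q,T\subseteq A$ the Hamming distance is $d(Q,T)=|Q\setminus T|+|T\setminus Q|$. For a committee $C$ and profile $P$, $D(C,P)=\max_{i\in N}d(C,P_i)$. The $k$-minimax approval voting rule returns a size-$k$ committee minimizing $D(\cdot,P)$. For $S\subseteq N$, $P_S$ and $P_{-S}$ denote the restrictions of the profile $P$ to the agents in $S$ and to the agents not in $S$, respectively. $R$ is strongly group-strategyproof if for every profile $P$ and every coalition $S\subseteq N$ there is no profile $P'_S$ of ballots of the agents in $S$ such that $d(P_i,R(P_S,P_{-S}))\ge d(P_i,R(P'_S,P_{-S}))$ for every $i\in S$, with strict inequality for at least one $i\in S$. *)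

(* Defs.v *)
From mathcomp Require Import all_boot all_order all_algebra.
From mathcomp Require Import reals.

Set Implicit Arguments.
Unset Strict Implicit.
Unset Printing Implicit Defensive.

Definition profile (N A : finType) := {ffun N -> {set A}}.

Definition hamming (A : finType) (Q T : {set A}) : nat :=
  #|Q :\: T| + #|T :\: Q|.

Definition maxdist (N A : finType) (C : {set A}) (P : profile N A) : nat :=
  \max_(i : N) hamming C (P i).

(* [#|A|] bounds every Hamming distance, so as the base value of the minimum
   it never beats an actual committee: when [k <= #|A|] this is a genuine
   minimum over the size-[k] committees; see [minimaxdist_le] and
   [minimaxdist_attained]. *)
Definition minimaxdist (N A : finType) (k : nat) (P : profile N A) : nat :=
  \big[Order.min/#|A|]_(K : {set A} | #|K| == k) maxdist K P.

Definition voting_rule (N A : finType) (k : nat)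
    (R : profile N A -> {set A}) : Prop :=
  forall P : profile N A, #|R P| = k.

(* The combined profile (P'_S, P_{-S}); only the ballots of the members of [S]
   in [P'] matter. *)
Definition deviate (N A : finType) (S : {set N}) (P' P : profile N A) :
    profile N A :=
  [ffun i => if i \in S then P' i else P i].

Definition strongly_group_strategyproof (N A : finType)
    (R : profile N A -> {set A}) : Prop :=
  forall (P : profile N A) (S : {set N}),
    ~ exists P' : profile N A,
        (forall i, i \in S ->
           hamming (P i) (R (deviate S P' P)) <= hamming (P i) (R P)) /\
        (exists2 i, i \in S &
           hamming (P i) (R (deviate S P' P)) < hamming (P i) (R P)).

Definition approx_ratio (N A : finType) (T : realType) (k : nat)
    (R : profile N A -> {set A}) (rho : T) : Prop :=
  forall P : profile N A,
    ((maxdist (R P) P)%:R <= rho * (minimaxdist k P)%:R :> T)%R.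

Lemma hamming_le (A : finType) (Q T : {set A}) : hamming Q T <= #|A|.
Proof.
rewrite /hamming -cardsUI.
have -> : (Q :\: T) :&: (T :\: Q) = set0.
  by apply/setP=> x; rewrite !inE; case: (x \in Q); case: (x \in T).
by rewrite cards0 addn0 max_card.
Qed.

Lemma maxdist_le (N A : finType) (C : {set A}) (P : profile N A) :
  maxdist C P <= #|A|.
Proof. by apply/bigmax_leqP=> i _; exact: hamming_le. Qed.

Lemma minimaxdist_le (N A : finType) (k : nat) (P : profile N A) (K : {set A}) :
  #|K| = k -> minimaxdist k P <= maxdist K P.
Proof.
move=> /eqP hK.
exact: (@Order.TotalTheory.bigmin_le_cond _ nat _ #|A| K
          (fun C : {set A} => #|C| == k) (fun C => maxdist C P) hK).
Qed.

Lemma minimaxdist_attained (N A : finType) (k : nat) (P : profile N A) :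
  k <= #|A| -> exists2 K : {set A}, #|K| = k & minimaxdist k P = maxdist K P.
Proof.
move=> kA.
have [K0 hK0] : exists K : {set A}, #|K| == k.
  exists [set x in take k (enum A)].
  rewrite cardsE (card_uniqP (take_uniq k (enum_uniq A))).
  by rewrite size_takel // -cardE.
case: (@arg_minnP _ K0 (fun K : {set A} => #|K| == k)
         (fun K => maxdist K P) hK0) => K hK Kmin.
exists K; first exact/eqP.
apply/eqP; rewrite eqn_leq minimaxdist_le ?(eqP hK) //=.
rewrite /minimaxdist; elim/big_ind: _ => [|x y hx hy|K' hK'].
- exact: maxdist_le.
- by rewrite Order.NatOrder.minEnat leq_min hx hy.
- exact: Kmin.
Qed.

(* Main.v *)
Require Import Defs.
From mathcomp Require Import all_boot all_order all_algebra.
From mathcomp Require Import reals.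
From mathcomp Require Import zify.

(** A finite ratio forces [R] to return [K] when all ballots equal a size-[k]
    set [K]; with the coalition [N], [R] is then Pareto optimal.  Fix [W] of
    size [k - 1] and look at profiles whose ballots all contain [W], one of
    them being [W] itself: the outcome is [W] plus one alternative.  If ballots
    [W + a] of [i] and [W + b] of [j] (all others [W]) yield [W + a], then no
    profile where [i] votes [W + a] yields [W + b]: otherwise everybody but [i]
    would move there.  This vetoing relation between alternatives does not
    depend on [i] and is a tournament.  Any three alternatives contain a path
    where [a] vetoes [b] and [b] vetoes [c].  At the ballots [W + b],
    [W + a + c], [W + c], [W], ..., the outcome is [W + b], as [c] dominates
    [a]; the second agent gains by voting [W + a], which vetoes [b]. *)

Section StrategyproofRule.

Context {N A : finType} {k : nat} {R : profile N A -> {set A}}.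
Hypothesis Rk : voting_rule k R.
Hypothesis Rsp : strongly_group_strategyproof R.

Lemma hammingE (Q C : {set A}) :
  hamming Q C + (#|Q :&: C|).*2 = #|Q| + #|C|.
Proof.
by rewrite /hamming -(cardsID C Q) -(cardsID Q C) (setIC C Q); lia.
Qed.

Lemma hamming_leE (Q C C' : {set A}) :
  #|C| = #|C'| -> (hamming Q C <= hamming Q C') = (#|Q :&: C'| <= #|Q :&: C|).
Proof. by move=> CC'; have := hammingE Q C; have := hammingE Q C'; lia. Qed.

Lemma coalition_no_gain (S : {set N}) (P P' : profile N A) :
  (forall i, i \notin S -> P' i = P i) ->
  (forall i, i \in S -> #|P i :&: R P| <= #|P i :&: R P'|) ->
  forall i, i \in S -> #|P i :&: R P'| <= #|P i :&: R P|.
Proof.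
move=> eqP' leS i iS; rewrite leqNgt; apply/negP=> lt_i.
have dev : deviate S P' P = P'.
  by apply/ffunP=> j; rewrite ffunE; case: ifPn => // /eqP' ->.
apply: (Rsp P S); exists P'; rewrite dev; split=> [j jS|].
  by rewrite hamming_leE ?Rk ?leS.
by exists i; rewrite // ltnNge hamming_leE ?Rk // -ltnNge.
Qed.

Hypothesis Runan : forall K : {set A}, #|K| = k -> R [ffun=> K] = K.

(** The coalition of all agents can impose [K] by voting for it unanimously. *)
Lemma pareto_optimal (P : profile N A) (K : {set A}) :
  #|K| = k -> (forall i, #|P i :&: R P| <= #|P i :&: K|) ->
  forall i, #|P i :&: K| <= #|P i :&: R P|.
Proof.
move=> Kk leK i.
have := @coalition_no_gain setT P [ffun=> K] _ _ i.
by rewrite Runan //; apply=> // j; rewrite inE.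
Qed.

Context {W : {set A}}.
Hypothesis Wk : #|W|.+1 = k.

Lemma cardIU1 (B : {set A}) x :
  W \subset B -> x \notin W -> #|B :&: (x |: W)| = (x \in B) + #|W|.
Proof.
move=> sWB xW; rewrite setIUr (setIidPr sWB).
case: (boolP (x \in B)) => xB.
  by rewrite (setIidPr _) ?sub1set // cardsU1 xW.
suff -> : B :&: [set x] = set0 by rewrite set0U.
by apply/eqP; rewrite setI_eq0 disjoint_sym disjoints1.
Qed.

Lemma outcome_form {P : profile N A} {j0} :
  (forall i, W \subset P i) -> P j0 = W ->
  exists2 x, x \notin W & R P = x |: W.
Proof.
move=> sWP Pj0.
have [sWR|/subsetPn[w wW wR]] := boolP (W \subset R P).
  have : #|R P :\: W| == 1.
    by have := cardsID W (R P); rewrite (setIidPr sWR) Rk -Wk; lia.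
  case/cards1P=> x xE; exists x.
    have : x \in R P :\: W by rewrite xE set11.
    by rewrite inE => /andP[].
  apply/setP=> y; rewrite -xE !inE.
  by have := subsetP sWR y; case: (y \in W) => /= [->|_]; rewrite ?orbF.
have /subsetPn[x xR xW] : ~~ (R P \subset W).
  by apply/negP=> /subset_leq_card; rewrite Rk -Wk ltnn.
have wRx : w \notin R P :\ x by rewrite inE (negPf wR) andbF.
(* Trading [x] for [w] hurts nobody and helps [j0], against Pareto optimality. *)
pose K := w |: (R P :\ x).
have KI (B : {set A}) : w \in B -> #|B :&: K| + (x \in B) = (#|B :&: R P|).+1.
  move=> wB.
  have -> : B :&: K = w |: ((B :&: R P) :\ x).
    apply/setP=> y; rewrite !inE; case: eqP => [->|_] /=; first by rewrite wB.
    by rewrite andbCA.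
  rewrite cardsU1 !inE (negPf wR) !andbF /= (cardsD1 x (B :&: R P)) inE xR andbT.
  by lia.
have Kk : #|K| = k.
  by have := cardsD1 x (R P); rewrite xR Rk cardsU1 wRx => ->.
have := @pareto_optimal P K Kk _ j0; rewrite Pj0.
have := KI W wW; rewrite (negPf xW) addn0 => ->.
rewrite ltnn => H; suff: false by []; apply: H => i.
have := KI (P i) (subsetP (sWP i) w wW).
by case: (x \in P i); rewrite ?addn0 ?addn1 => -[->].
Qed.

(** Otherwise [y |: W] would Pareto-dominate the outcome. *)
Lemma outcome_undominated {P : profile N A} {x y} :
  (forall i, W \subset P i) -> x \notin W -> y \notin W -> R P = x |: W ->
  (forall i, x \in P i -> y \in P i) -> forall i, y \in P i -> x \in P i.
Proof.
move=> sWP xW yW RP xy i yi.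
have := @pareto_optimal P (y |: W) _ _ i.
rewrite RP !cardIU1 // yi cardsU1 yW => /(_ Wk).
case: (x \in P i) => // H; suff : 1 + #|W| <= 0 + #|W| by rewrite ltnn.
apply: H => j; rewrite !cardIU1 // leq_add2r.
by case: (boolP (x \in P j)) => // /xy ->.
Qed.

(** Only the ballot of [i] is fixed; the others are arbitrary and may even miss part of [W]. *)
Definition vetoes i a b : bool :=
  [forall P : profile N A, (P i == a |: W) ==> (R P != b |: W)].

Lemma vetoesP {i a b} {P : profile N A} :
  vetoes i a b -> P i = a |: W -> R P <> b |: W.
Proof.
by move=> /forallP/(_ P)/implyP v Pi; apply/eqP/v; rewrite Pi.
Qed.

(** Were the veto to fail at some profile, all agents but [i] could move there: [j] gains, and the
    voters of [W] are indifferent. *)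
Lemma vetoes_of_duel {i j a b} {P : profile N A} :
  i != j -> a != b -> a \notin W -> b \notin W ->
  P i = a |: W -> P j = b |: W ->
  (forall l, l != i -> l != j -> P l = W) ->
  R P = a |: W -> vetoes i a b.
Proof.
move=> ij ab aW bW Pi Pj Pl RP.
apply/forallP=> P'; apply/implyP=> /eqP P'i; apply/eqP=> RP'.
have sWP l : W \subset P l.
  have [->|li] := eqVneq l i; first by rewrite Pi subsetUr.
  have [->|lj] := eqVneq l j; first by rewrite Pj subsetUr.
  by rewrite Pl.
have := @coalition_no_gain [set~ i] P P' _ _ j.
rewrite RP RP' !cardIU1 // Pj !inE eqxx (negPf ab) (negPf aW) /=.
rewrite eq_sym ij => H; suff : 1 + #|W| <= 0 + #|W| by rewrite ltnn.
apply: H => // l; first by rewrite !inE negbK => /eqP->; rewrite P'i Pi.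
rewrite !inE => li.
rewrite !cardIU1 // leq_add2r.
have [->|lj] := eqVneq l j.
  by rewrite Pj !inE (negPf ab) (negPf aW).
by rewrite Pl // (negPf aW).
Qed.

Lemma vetoes_antisym i j l a b :
  i != j -> l != i -> l != j -> a != b -> a \notin W -> b \notin W ->
  vetoes i a b = ~~ vetoes j b a.
Proof.
move=> ij li lj ab aW bW.
pose P : profile N A :=
  [ffun t => if t == i then a |: W else if t == j then b |: W else W].
have Pi : P i = a |: W by rewrite ffunE eqxx.
have Pj : P j = b |: W by rewrite ffunE eq_sym (negPf ij) eqxx.
have Pt t : t != i -> t != j -> P t = W.
  by rewrite ffunE => /negPf-> /negPf->.
have sWP t : W \subset P t by rewrite ffunE; do 2?case: ifP; rewrite ?subsetUr.
have [x xW RP] := outcome_form sWP (Pt l li lj).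
(* An alternative outside [W] that nobody approves is dominated by [a]. *)
have : (x == a) || (x == b).
  have [/existsP[t]|nox] := boolP [exists t, x \in P t].
    rewrite ffunE; do 2?case: ifP => _; rewrite ?inE (negPf xW) ?orbF // => ->;
    by rewrite ?orbT.
  have /= := outcome_undominated sWP xW aW RP _ i.
  rewrite Pi setU11 !inE (negPf xW) orbF => -> // t xt.
  by case/negP: nox; apply/existsP; exists t.
(* The winner of the duel vetoes the loser, and the same profile refutes the opposite veto. *)
case/orP=> /eqP xE; rewrite {}xE {x xW} in RP.
  rewrite (vetoes_of_duel ij ab aW bW Pi Pj Pt RP).
  by apply/esym/negP=> v; exact: vetoesP v Pj RP.
rewrite (vetoes_of_duel _ _ bW aW Pj Pi _ RP) 1?eq_sym //.
  by apply/negP=> v; exact: vetoesP v Pi RP.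
by move=> t tj ti; exact: Pt.
Qed.

Lemma vetoes_no_path i1 i2 i3 i4 a b c :
  uniq [:: i1; i2; i3; i4] -> uniq [:: a; b; c] ->
  a \notin W -> b \notin W -> c \notin W ->
  vetoes i2 a b -> vetoes i1 b c -> False.
Proof.
rewrite /= !inE !negb_or !andbT => /and3P[/and3P[i12 i13 i14] /andP[i23 i24] i34].
move=> /andP[/andP[ab ac] bc] aW bW cW vab vbc.
(* [B] is what [i2] adds to [W]: [[set a; c]] when sincere, [[set a]] when misreporting. *)
pose P B : profile N A := [ffun t => if t == i1 then b |: W
  else if t == i2 then B :|: W else if t == i3 then c |: W else W].
have P1 B : P B i1 = b |: W by rewrite ffunE eqxx.
have P2 B : P B i2 = B :|: W.
  by rewrite ffunE eq_sym (negPf i12) eqxx.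
have P3 B : P B i3 = c |: W.
  by rewrite ffunE ![i3 == _]eq_sym (negPf i13) (negPf i23) eqxx.
have P4 B : P B i4 = W.
  by rewrite ffunE ![i4 == _]eq_sym (negPf i14) (negPf i24) (negPf i34).
have sWP B t : W \subset P B t.
  by rewrite ffunE; do 3?case: ifP => _; rewrite ?subsetUr.
(* Any other alternative outside [W] has no approval, so [b], approved by [i1], dominates it. *)
have outcome (B : {set A}) : B \subset [set a; c] ->
    exists2 x, x \in [:: a; b; c] & R (P B) = x |: W.
  move=> sB; have [x xW RP] := outcome_form (sWP B) (P4 B); exists x => //.
  apply/negPn/negP; rewrite !inE !negb_or => /and3P[xa xb xc].
  have := outcome_undominated (sWP B) xW bW RP _ i1.
  rewrite P1 setU11 !inE (negPf xb) (negPf xW) => /(_ _ isT) H.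
  suff: false by []; apply: H => t; rewrite ffunE.
  have xB : x \in B = false.
    by apply/negP=> /(subsetP sB); rewrite !inE (negPf xa) (negPf xc).
  by do 3?case: ifP => _; rewrite ?inE ?xB ?(negPf xa) ?(negPf xb) ?(negPf xc)
    ?(negPf xW).
(* Here [a] loses to [c], which [i3] approves as well, and [i1] vetoes [c]. *)
have RPac : R (P [set a; c]) = b |: W.
  have [x] := outcome _ (subxx _); rewrite !inE => /or3P[] /eqP-> // RP.
    have := outcome_undominated (sWP _) aW cW RP _ i3.
    rewrite P3 !inE eqxx (negPf ac) (negPf aW) /= => H.
    suff: false by []; apply: H => // t; rewrite ffunE.
    do 3?case: ifP => _; rewrite ?inE ?eqxx ?orbT //;
    by rewrite ?(negPf ab) ?(negPf ac) ?(negPf aW).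
  by case: (vetoesP vbc (P1 _) RP).
have [|x xabc RPa] := outcome [set a]; first by rewrite sub1set set21.
(* The misreport vetoes [b], which leaves an alternative that [i2] sincerely approves. *)
have xac : x \in [set a; c].
  move: xabc RPa; rewrite !inE => /or3P[] /eqP->; rewrite ?eqxx ?orbT // => RPb.
  by case: (vetoesP vab (P2 _) RPb).
have xW : x \notin W by move: xac; rewrite !inE => /orP[] /eqP->.
have := @coalition_no_gain [set i2] (P [set a; c]) (P [set a]) _ _ i2.
rewrite RPac RPa !cardIU1 // P2 !inE eqxx.
move: xac; rewrite !inE => -> /=.
rewrite eq_sym (negPf ab) (negPf bc) (negPf bW) /= => H.
suff : 1 + #|W| <= 0 + #|W| by rewrite ltnn.
apply: H => // t; rewrite !inE; first by move=> /negPf ti; rewrite !ffunE ti.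
move=> /eqP->.
rewrite !cardIU1 // P2 !inE leq_add2r.
by rewrite eq_sym (negPf ab) (negPf bc) (negPf bW).
Qed.

End StrategyproofRule.

(** A unanimous profile has optimum 0, and a finite ratio keeps it 0. The agent [i] ensures that the
    maximum is not over an empty set. *)
Lemma approx_ratio_unanimous {T : realType} {N A : finType} {k : nat}
    {R : profile N A -> {set A}} {rho : T} (i : N) :
  approx_ratio k R rho ->
  forall K : {set A}, #|K| = k -> R [ffun=> K] = K.
Proof.
move=> apx K Kk; set P : profile N A := [ffun=> K].
have DK : maxdist K P = 0.
  apply/eqP; rewrite -leqn0; apply/bigmax_leqP=> j _.
  by rewrite ffunE /hamming setDv cards0.
have := apx P; have := minimaxdist_le P Kk.
rewrite DK leqn0 => /eqP->; rewrite GRing.mulr0 Num.Theory.lern0 => /eqP DR.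
have := leq_bigmax (F := fun j => hamming (R P) (P j)) i.
rewrite -/(maxdist (R P) P) DR leqn0 ffunE /hamming addn_eq0 !cards_eq0 !setD_eq0.
by move=> /andP[s1 s2]; apply/eqP; rewrite eqEsubset s1.
Qed.

Theorem theorem8 (T : realType) (m k n : nat) (N A : finType)
    (R : profile N A -> {set A}) :
  3 <= m -> 1 <= k <= m - 2 -> 6 <= n ->
  #|N| = n -> #|A| = m ->
  voting_rule k R ->
  strongly_group_strategyproof R ->
  ~ exists rho : T, (1 <= rho)%R /\ approx_ratio k R rho.
Proof.
move=> m3 /andP[k1 km] n6 Nn Am Rk Rsp [rho [_ apx]].
have [i1 [i2 [i3 [i4 i_uniq]]]] : exists i1 i2 i3 i4 : N, uniq [:: i1; i2; i3; i4].
  have := enum_uniq N; have : 3 < size (enum N) by rewrite -cardE Nn; lia.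
  case: (enum N) => [|i1 [|i2 [|i3 [|i4 s]]]] // _ /(take_uniq 4) u.
  by exists i1, i2, i3, i4; move: u; rewrite /= take0.
have Runan := approx_ratio_unanimous i1 apx.
(* As [k <= m - 2], at least three alternatives stay outside [W]. *)
pose W := [set x in take k.-1 (enum A)].
have Wk : #|W|.+1 = k.
  rewrite cardsE (card_uniqP (take_uniq _ (enum_uniq A))) size_takel ?prednK //.
  by rewrite -cardE Am; lia.
have [a [b [c [abc aW bW cW]]]] :
    exists a b c, [/\ uniq [:: a; b; c], a \notin W, b \notin W & c \notin W].
  have := enum_uniq (~: W).
  have : 2 < size (enum (~: W)) by rewrite -cardE; have := cardsC W; rewrite Am; lia.
  have : forall x, x \in enum (~: W) -> x \notin W by move=> x; rewrite mem_enum inE.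
  case: (enum _) => [|a [|b [|c s]]] // nW _ /(take_uniq 3) u.
  exists a, b, c; move: u; rewrite /= take0 => u.
  by split; rewrite ?nW // !inE eqxx ?orbT.
have := i_uniq; rewrite /= !inE !negb_or !andbT.
move=> /and3P[/and3P[i12 i13 i14] /andP[i23 i24] i34].
pose v := @vetoes N A R W i1.
(* Both sides equal [~~ vetoes i3 y x], with [i4] as the voter of [W]. *)
have v2 x y : x != y -> x \notin W -> y \notin W -> @vetoes N A R W i2 x y = v x y.
  move=> xy xW yW; have anti := vetoes_antisym Rk Rsp Runan Wk.
  by rewrite /v (anti i2 i3 i4 x y) ?(anti i1 i3 i4 x y) // eq_sym.
have v_antisym x y : x != y -> x \notin W -> y \notin W -> v x y = ~~ v y x.
  move=> xy xW yW; rewrite -v2 //.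
  by apply: (vetoes_antisym Rk Rsp Runan Wk i2 i1 i3); rewrite // eq_sym.
have no_path x y z : x != y -> x != z -> y != z ->
    x \notin W -> y \notin W -> z \notin W -> v x y -> ~~ v y z.
  move=> xy xz yz xW yW zW vxy; apply/negP; move: vxy; rewrite -v2 //.
  apply: (vetoes_no_path Rk Rsp Runan Wk i1 i2 i3 i4) => //.
  by rewrite /= !inE negb_or xy xz yz.
(* Given [v x y], the absence of paths forces [v z y]; then either orientation between [x] and [z]
   creates a path ending in [y]. *)
have no_arc x y z : x != y -> x != z -> y != z ->
    x \notin W -> y \notin W -> z \notin W -> ~~ v x y.
  move=> xy xz yz xW yW zW; apply/negP=> vxy.
  have vzy : v z y.
    by rewrite v_antisym 1?eq_sym // (no_path x y z).
  case: (boolP (v x z)) => [vxz|nvxz].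
    by have := no_path x z y xz xy; rewrite eq_sym vzy => /(_ yz xW zW yW vxz).
  have vzx : v z x by rewrite v_antisym 1?eq_sym.
  have := no_path z x y; rewrite vxy ![z == _]eq_sym.
  by move=> /(_ xz yz xy zW xW yW vzx).
move: abc; rewrite /= !inE !negb_or !andbT => /andP[/andP[ab ac] bc].
(* A tournament must have an arc between [a] and [b], yet neither orientation is possible. *)
have := no_arc a b c ab ac bc aW bW cW; rewrite v_antisym // negbK.
by apply/negP/(no_arc b a c); rewrite // eq_sym.
Qed.
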